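(* Let $\mathcal{D}\subseteq\mathbb{R}^n$ be a convex set and, for every $\omega\in\Omega$, let $f(x,\omega)=p(x,\omega)-q(x,\omega)$ be a dc decomposition of $f(\cdot,\omega)$ on $\mathcal{D}$ with $p(\cdot,\omega)$ and $q(\cdot,\omega)$ both nonnegative and convex. Then for $x\in\mathcal{D}$, $$\sigma^2(f(x,\tilde\omega))=\Big\{2\,\mathbb{E}\big[p(x,\tilde\omega)^2+q(x,\tilde\omega)^2\big]+\big(\mathbb{E}p(x,\tilde\omega)+\mathbb{E}q(x,\tilde\omega)\big)^2\Big\}-\Big\{\mathbb{E}\big[(p(x,\tilde\omega)+q(x,\tilde\omega))^2\big]+2\big[(\mathbb{E}p(x,\tilde\omega))^2+(\mathbb{E}q(x,\tilde\omega))^2\big]\Big\},$$ and each of the two expressions in braces is a convex function of $x$ on $\mathcal{D}$.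
   Context: $\tilde\omega$ is a random variable on a probability space $(\Omega,\mathcal{F},\mathbb{P})$; $\sigma^2(\mathcal{Z})=\mathbb{E}[(\mathcal{Z}-\mathbb{E}\mathcal{Z})^2]$ is the variance. It is assumed that $p(x,\cdot)$ and $q(x,\cdot)$ are measurable and square integrable for each $x\in\mathcal{D}$. *)

(* Defs.v *)
From HB Require Import structures.
From mathcomp Require Import all_boot all_order all_algebra.
From mathcomp Require Import all_classical all_reals all_analysis.

Set Implicit Arguments.
Unset Strict Implicit.
Unset Printing Implicit Defensive.

Import Order.TTheory GRing.Theory Num.Theory.
Import numFieldNormedType.Exports.

Local Open Scope classical_set_scope.
Local Open Scope ring_scope.

(* Only the values on D matter: the functions are total, but f, p and q are
   unconstrained outside D. *)
Definition dc_decomposition (R : realType) (E : lmodType R) (D : set E)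
    (f p q : E -> R) : Prop :=
  [/\ convex_function D p, convex_function D q
    & forall x, x \in D -> f x = p x - q x].

(* Expectations are extended real numbers. For square integrable X and Y, the
   next two quantities are finite and 'V_P[X - Y] is their difference. *)
Definition dc_variance_pos (d : measure_display) (T : measurableType d)
    (R : realType) (P : probability T R) (X Y : T -> R) : \bar R :=
  (2%:E * 'E_P[(fun t => X t ^+ 2 + Y t ^+ 2)%R] + ('E_P[X] + 'E_P[Y]) ^+ 2)%E.

Definition dc_variance_neg (d : measure_display) (T : measurableType d)
    (R : realType) (P : probability T R) (X Y : T -> R) : \bar R :=
  ('E_P[(fun t => (X t + Y t) ^+ 2)%R] + 2%:E * ('E_P[X] ^+ 2 + 'E_P[Y] ^+ 2))%E.

(* Main.v *)
(* The variance identity is the parallelogram law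
   (X - Y)^2 = 2 (X^2 + Y^2) - (X + Y)^2 applied once under the expectation and
   once to the expectations. Convexity holds because squaring preserves
   convexity of nonnegative functions and the expectation is linear and
   monotone. *)
Require Import Defs.
From HB Require Import structures.
From mathcomp Require Import all_boot all_order all_algebra.
From mathcomp Require Import all_classical all_reals all_analysis.
From mathcomp Require Import ring.

Set Implicit Arguments.
Unset Strict Implicit.
Unset Printing Implicit Defensive.

Import Order.TTheory GRing.Theory Num.Theory.
Import numFieldNormedType.Exports.

Local Open Scope classical_set_scope.
Local Open Scope ring_scope.

Section convex_function_lemmas.
Context (R : realType) (E : lmodType R) (D : set E).
Implicit Types f g : E -> R.

(** Since [D] is convex, the combination point also lies in [D], so only values on [D] enter. This
    lets formulas proved only under membership in [D] be substituted for the braces. *)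
Lemma eq_in_convex_function f g :
  convex_set D -> {in D, f =1 g} -> convex_function D f -> convex_function D g.
Proof.
move=> cD fg cf t x y xD yD.
by rewrite -!fg//; [exact: cf | exact: cD].
Qed.

Lemma convex_functionD f g : convex_function D f -> convex_function D g ->
  convex_function D (f \+ g).
Proof.
move=> cf cg t x y xD yD.
have := lerD (cf t x y xD yD) (cg t x y xD yD).
by rewrite !convRE /= !mulrDr addrACA.
Qed.

Lemma convex_functionZ (a : R) f : 0 <= a -> convex_function D f ->
  convex_function D (fun x => a * f x).
Proof.
move=> a0 cf t x y xD yD.
have := ler_wpM2l a0 (cf t x y xD yD).
by rewrite !convRE /= mulrDr !(mulrCA a).
Qed.

(** Nonnegativity makes squaring monotone, so the convexity inequality may be squared. The square
    itself is convex because t a^2 + (1 - t) b^2 exceeds (t a + (1 - t) b)^2 by t (1 - t) (a -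
    b)^2. *)
Lemma convex_function_sqr f : convex_set D -> {in D, forall x, 0 <= f x} ->
  convex_function D f -> convex_function D (fun x => f x ^+ 2).
Proof.
move=> cD f0 cf t x y xD yD; rewrite !convRE.
have := cf t x y xD yD; rewrite convRE => cfxy.
have f0xy := f0 _ (cD x y t xD yD).
apply: (@le_trans _ _ ((t%:num * f x + (1 - t%:num) * f y) ^+ 2)).
  by rewrite ler_pXn2r// nnegrE (le_trans f0xy).
rewrite -subr_ge0.
have -> : t%:num * f x ^+ 2 + (1 - t%:num) * f y ^+ 2
    - (t%:num * f x + (1 - t%:num) * f y) ^+ 2
    = t%:num * (1 - t%:num) * (f x - f y) ^+ 2 by ring.
by rewrite mulr_ge0 ?sqr_ge0// mulr_ge0// subr_ge0.
Qed.

End convex_function_lemmas.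

Section real_expectation.
Context d (T : measurableType d) (R : realType) (P : probability T R).
Implicit Types X Y : T -> R.

Lemma Lfun2_Lfun1 X : X \in Lfun P 2%:E -> X \in Lfun P 1.
Proof. by move=> X2; rewrite Lfun_subset12// fin_num_measure. Qed.

Lemma Lfun2_sqr_Lfun1 X :
  X \in Lfun P 2%:E -> (fun t => X t ^+ 2) \in Lfun P 1.
Proof. by move=> X2; exact: (Lfun2_mul_Lfun1 X2 X2). Qed.

Lemma le_fine_expectation X Y : X \in Lfun P 1 -> Y \in Lfun P 1 ->
  (forall t, X t <= Y t) -> fine 'E_P[X] <= fine 'E_P[Y].
Proof.
move=> X1 Y1 XY; rewrite fine_le ?expectation_fin_num// unlock.
apply: le_integral => //; [exact/Lfun1_integrable|exact/Lfun1_integrable|].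
by move=> t _; rewrite lee_fin.
Qed.

Lemma fine_expectationD X Y : X \in Lfun P 1 -> Y \in Lfun P 1 ->
  fine 'E_P[X \+ Y] = fine 'E_P[X] + fine 'E_P[Y].
Proof. by move=> X1 Y1; rewrite expectationD// fineD ?expectation_fin_num. Qed.

Lemma fine_expectationZl X (k : R) : X \in Lfun P 1 ->
  fine 'E_P[k \o* X] = k * fine 'E_P[X].
Proof. by move=> X1; rewrite expectationZl// fineM ?expectation_fin_num. Qed.

Lemma fine_expectationB X Y : X \in Lfun P 1 -> Y \in Lfun P 1 ->
  fine 'E_P[X \- Y] = fine 'E_P[X] - fine 'E_P[Y].
Proof. by move=> X1 Y1; rewrite expectationB// fineB ?expectation_fin_num. Qed.

(** The convexity inequality holds at each outcome and is integrated. Convexity of [D] supplies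
    integrability at the combination point. *)
Lemma convex_function_fine_expectation (E : lmodType R) (D : set E)
    (g : E -> T -> R) :
  convex_set D -> {in D, forall x, g x \in Lfun P 1} ->
  (forall t, convex_function D (g^~ t)) ->
  convex_function D (fun x => fine 'E_P[g x]).
Proof.
move=> cD g1 cg s x y xD yD.
have Zg1 k z : z \in D -> (k \o* g z) \in Lfun P 1.
  by move=> zD; apply: Lfun_scale => //; exact: g1.
rewrite convRE -!fine_expectationZl ?g1// -fine_expectationD ?Zg1//.
apply: le_fine_expectation; [exact/g1/cD|by rewrite rpredD ?Zg1|].
(* [\o*] puts the scalar on the right of the function value, hence the commutation below. *)
move=> t; have := cg t s x y xD yD.
by rewrite convRE /= !(mulrC (g _ t)).
Qed.

End real_expectation.

Section dc_variance.
Context d (T : measurableType d) (R : realType) (P : probability T R).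
Variables X Y : T -> R.
Hypotheses (X2 : X \in Lfun P 2%:E) (Y2 : Y \in Lfun P 2%:E).

Let X1 := Lfun2_Lfun1 X2.
Let Y1 := Lfun2_Lfun1 Y2.

Lemma sum_sqr_Lfun1 : (fun t => X t ^+ 2 + Y t ^+ 2) \in Lfun P 1.
Proof. by apply: rpredD; exact: Lfun2_sqr_Lfun1. Qed.

Lemma sqr_sum_Lfun1 : (fun t => (X t + Y t) ^+ 2) \in Lfun P 1.
Proof. by apply: (@Lfun2_sqr_Lfun1 _ _ _ _ (X \+ Y)); rewrite rpredD ?lee1n. Qed.

(** Integrability makes every expectation finite, so the brace is an embedded real and the remaining
    work can be done in [R]. *)
Lemma dc_variance_posE : dc_variance_pos P X Y =
  (2 * fine 'E_P[(fun t => X t ^+ 2 + Y t ^+ 2)]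
   + (fine 'E_P[X] + fine 'E_P[Y]) ^+ 2)%:E.
Proof.
have /fineK EX := expectation_fin_num X1.
have /fineK EY := expectation_fin_num Y1.
have /fineK EXY := expectation_fin_num sum_sqr_Lfun1.
rewrite /dc_variance_pos -[in LHS]EX -[in LHS]EY -[in LHS]EXY.
by rewrite -(EFinD (fine 'E_P[X])) -EFin_expe.
Qed.

Lemma dc_variance_negE : dc_variance_neg P X Y =
  (fine 'E_P[(fun t => (X t + Y t) ^+ 2)]
   + 2 * (fine 'E_P[X] ^+ 2 + fine 'E_P[Y] ^+ 2))%:E.
Proof.
have /fineK EX := expectation_fin_num X1.
have /fineK EY := expectation_fin_num Y1.
have /fineK EXY := expectation_fin_num sqr_sum_Lfun1.
rewrite /dc_variance_neg -[in LHS]EX -[in LHS]EY -[in LHS]EXY.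
by rewrite -!EFin_expe.
Qed.

Lemma variance_dcE :
  ('V_P[(X \- Y)%R] = dc_variance_pos P X Y - dc_variance_neg P X Y)%E.
Proof.
have XY2 : X \- Y \in Lfun P 2%:E by rewrite rpredB ?lee1n.
rewrite dc_variance_posE dc_variance_negE varianceE//.
rewrite -[in LHS](fineK (expectation_fin_num (Lfun2_Lfun1 XY2))).
rewrite -[in LHS](fineK (expectation_fin_num (Lfun2_sqr_Lfun1 XY2))).
rewrite -EFin_expe -!EFinB; congr EFin.
(* First use of the parallelogram law, at each outcome; linearity then splits the second moment. *)
have -> : (fun t => (X \- Y) t ^+ 2) =
    ((2 \o* (fun t => X t ^+ 2 + Y t ^+ 2)) \- (fun t => (X t + Y t) ^+ 2))%R.
  by apply/funext => t /=; ring.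
rewrite !fine_expectationB ?fine_expectationZl ?sum_sqr_Lfun1 ?sqr_sum_Lfun1//.
  (* Second use of the parallelogram law, on the two means. *)
  by ring.
by apply: Lfun_scale; rewrite ?sum_sqr_Lfun1.
Qed.

End dc_variance.

(** Finiteness is part of the conclusion because [fine] sends infinite values to 0; it ensures that
    on [D] the convexity claims concern the actual braces. *)
Theorem proposition4 (R : realType) (n : nat)
    (d d' : measure_display) (T : measurableType d) (T' : measurableType d')
    (P : probability T R) (omega : {RV P >-> T'})
    (D : set 'rV[R]_n) (f p q : 'rV[R]_n -> T' -> R) :
  convex_set D ->
  (forall w : T', dc_decomposition D (f^~ w) (p^~ w) (q^~ w)) ->
  (forall (w : T') (x : 'rV[R]_n), x \in D -> 0 <= p x w /\ 0 <= q x w) ->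
  (forall x, x \in D ->
     measurable_fun [set: T'] (p x) /\ measurable_fun [set: T'] (q x)) ->
  (forall x, x \in D ->
     p x \o omega \in Lfun P 2%:E /\ q x \o omega \in Lfun P 2%:E) ->
  [/\ forall x, x \in D ->
        [/\ dc_variance_pos P (p x \o omega) (q x \o omega) \is a fin_num,
            dc_variance_neg P (p x \o omega) (q x \o omega) \is a fin_num
          & 'V_P[f x \o omega] =
            (dc_variance_pos P (p x \o omega) (q x \o omega) -
             dc_variance_neg P (p x \o omega) (q x \o omega))%E],
      convex_function D
        (fun x => fine (dc_variance_pos P (p x \o omega) (q x \o omega)))
    & convex_function D
        (fun x => fine (dc_variance_neg P (p x \o omega) (q x \o omega)))].
Proof.
move=> cD dc pq0 _ pq2.
have cp w : convex_function D (p^~ w) by have [] := dc w.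
have cq w : convex_function D (q^~ w) by have [] := dc w.
have p0 w : {in D, forall x, 0 <= p x w} by move=> x /(pq0 w)[].
have q0 w : {in D, forall x, 0 <= q x w} by move=> x /(pq0 w)[].
have p2 x : x \in D -> p x \o omega \in Lfun P 2%:E by move=> /pq2[].
have q2 x : x \in D -> q x \o omega \in Lfun P 2%:E by move=> /pq2[].
have cEp : convex_function D (fun x => fine 'E_P[p x \o omega]).
  apply: convex_function_fine_expectation => [|x /p2 /Lfun2_Lfun1|t] //.
  exact: cp.
have cEq : convex_function D (fun x => fine 'E_P[q x \o omega]).
  apply: convex_function_fine_expectation => [|x /q2 /Lfun2_Lfun1|t] //.
  exact: cq.
(* The means inherit nonnegativity, which is needed to square them and their sum. *)
have Ep0 : {in D, forall x, 0 <= fine 'E_P[p x \o omega]}.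
  by move=> x xD; rewrite fine_ge0// expectation_ge0// => t; exact: p0.
have Eq0 : {in D, forall x, 0 <= fine 'E_P[q x \o omega]}.
  by move=> x xD; rewrite fine_ge0// expectation_ge0// => t; exact: q0.
split.
- move=> x xD; have [px2 qx2] := pq2 x xD.
  split; [by rewrite dc_variance_posE|by rewrite dc_variance_negE|].
  rewrite -variance_dcE//; congr variance.
  (* The decomposition holds at every outcome, so the random variables are equal as functions. *)
  by apply/funext => t /=; have [_ _ ->] := dc (omega t).
(* The real closed form is available only on [D], where square integrability is assumed. *)
- apply: (eq_in_convex_function cD) => [x xD|].
    by rewrite dc_variance_posE ?p2 ?q2//=.
  apply: convex_functionD.
    apply: convex_functionZ => //.
    apply: convex_function_fine_expectation => // [x xD|t].
      by rewrite sum_sqr_Lfun1 ?p2 ?q2.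
    by apply: convex_functionD; apply: convex_function_sqr => //; exact: p0.
  apply: convex_function_sqr => // [x xD|]; last exact: convex_functionD.
  by rewrite addr_ge0 ?Ep0 ?Eq0.
- apply: (eq_in_convex_function cD) => [x xD|].
    by rewrite dc_variance_negE ?p2 ?q2//=.
  apply: convex_functionD.
    apply: convex_function_fine_expectation => // [x xD|t].
      by rewrite sqr_sum_Lfun1 ?p2 ?q2.
    apply: convex_function_sqr => // [x xD|]; last exact: convex_functionD.
    by rewrite addr_ge0 ?p0 ?q0.
  by apply: convex_functionZ => //; apply: convex_functionD;
    exact: convex_function_sqr.
Qed.
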